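(* Let $A_1,\ldots,A_n\subset\mathbb Z^n$ be finite, $\mathcal A=(A_1,\ldots,A_n)$, let $C_1,\ldots,C_n$ be positive definite diagonal matrices ($C_i$ indexed by $A_i$), and let $f\in\mathcal F_{\mathbb C}(\mathcal A)$. If $(p,q)\in\mathcal T^n$ is a non-degenerate root of $f$, then $$\max_{\|\dot f\|\le1}\ \min_i\|DG_f\dot f\|_{A_i}\ \le\ \frac1{d_{\mathbb P}(f,\Sigma_{(p,q)})}\ \le\ \max_{\|\dot f\|\le1}\ \max_i\|DG_f\dot f\|_{A_i}.$$ In particular, if $A_1=\cdots=A_n$ and $C_1=\cdots=C_n$, then $$\max_{\|\dot f\|\le1}\min_i\|DG_f\dot f\|_{A_i}=\max_i\max_{\|\dot f\|\le1}\|DG_f\dot f\|_{A_i}=\frac1{d_{\mathbb P}(f,\Sigma_{(p,q)})},$$ and one can define the condition number $\boldsymbol\mu(f;(p,q))$ to be any of these three quantities.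
   Context: For a finite $A\subset\mathbb Z^n$, $\mathcal F_{\mathbb C}(A)$ is the complex vector space of (Laurent) polynomials $\sum_{a\in A}c_ax^a$, $c_a\in\mathbb C$; $\mathcal F_{\mathbb C}(\mathcal A)=\prod_i\mathcal F_{\mathbb C}(A_i)$, with elements $f=(f^1,\ldots,f^n)$. For $f^i=\sum_ac_ax^a$ put $\|f^i\|^2=\sum_{a\in A_i}|c_a|^2/(C_i)_{aa}$, and $\|f\|^2=\sum_i\|f^i\|^2$; the same norm is used for tangent vectors $\dot f\in T_f\mathcal F_{\mathbb C}(\mathcal A)=\mathcal F_{\mathbb C}(\mathcal A)$. For $f$ with all $f^i\neq0$ (automatic when $f$ has a non-degenerate root) and $g\in\mathcal F_{\mathbb C}(\mathcal A)$, $$d_{\mathbb P}(f,g)=\left(\sum_{i=1}^n\inf_{\lambda\in\mathbb C^*}\frac{\|f^i-\lambda g^i\|^2}{\|f^i\|^2}\right)^{1/2},\qquad d_{\mathbb P}(f,S)=\inf_{g\in S}d_{\mathbb P}(f,g).$$ $\mathcal T^n=(\mathbb R\times(\mathbb R\bmod2\pi))^n$ with coordinates $(p,q)$ or $p+iq$, and $\exp(p+iq)=(e^{p_1+iq_1},\ldots,e^{p_n+iq_n})$. We say $(p,q)$ is a root of $f$ if $f(\exp(p+iq))=0$; it is non-degenerate if the Jacobian matrix of $f$ at $\exp(p+iq)$ has rank $n$. $\Sigma_{(p,q)}$ is the set of $g\in\mathcal F_{\mathbb C}(\mathcal A)$ having $(p,q)$ as a degenerate root, i.e. $g(\exp(p+iq))=0$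 with Jacobian of rank $<n$ there. $G$ is the unique branch of the implicit function defined near $f$ by $G(f)=p+iq$ and $g(\exp(G(g)))=0$ for all $g$ near $f$; $DG_f:\mathcal F_{\mathbb C}(\mathcal A)\to T_{(p,q)}\mathcal T^n\cong\mathbb C^n$ is its derivative at $f$. On $T_{(p,q)}\mathcal T^n\cong\mathbb C^n$, $$\|u\|_{A_i}^2=u^H\left(\tfrac12D^2g_{A_i}(p)\right)u,\qquad g_{A_i}(p)=\tfrac12\log\sum_{a\in A_i}(C_i)_{aa}e^{2a\cdot p},$$ where $D^2g_{A_i}$ is the Hessian matrix of $g_{A_i}$ with respect to $p$ and $u^H$ is the conjugate transpose of $u$.
   Formalization: The unit ball for the tangent vector is taken in the scaled norm (sum_i ||fdot^i||^2/||f^i||^2)^(1/2), which equals ||fdot|| when all ||f^i|| = 1; with the unscaled norm the claim fails, e.g. for f = t(x-1) at x = 1 unless ||f|| = 1. *)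

(* Defs.v *)
From HB Require Import structures.
From mathcomp Require Import all_boot all_order all_algebra finmap.
From mathcomp Require Import all_classical all_reals all_analysis.
From mathcomp Require Import complex.

Set Implicit Arguments.
Unset Strict Implicit.
Unset Printing Implicit Defensive.

Import Order.TTheory GRing.Theory Num.Theory numFieldNormedType.Exports.

Local Open Scope classical_set_scope.
Local Open Scope complex_scope.
Local Open Scope ring_scope.

(* The library topologizes an abstract numFieldType K through K^o; this makes
   the same structure available on the concrete R[i]. *)
HB.instance Definition _ (R : realType) := NormedModule.copy R[i] R[i]^o.

Definition is_max (R : realType) (S : set R) (m : R) : Prop :=
  S m /\ ubound S m.

Section Torus.
Context (R : realType) (n : nat).

Definition cexp (z : R[i]) : R[i] :=
  (expR (complex.Re z))%:C * (cos (complex.Im z) +i* sin (complex.Im z)).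

Definition cexpv (w : 'rV[R[i]]_n) : 'rV[R[i]]_n := map_mx cexp w.

(* A point (p, q) of (R x R/2piZ)^n is given by p and a real representative of
   q; whatever is evaluated at it only depends on cexpv (torus_point p q),
   hence only on q mod 2pi. *)
Definition torus_point (p q : 'rV[R]_n) : 'rV[R[i]]_n :=
  \row_j (p ord0 j +i* q ord0 j).

End Torus.

Section OneSupport.
Context (R : realType) (n : nat) (A : {fset 'rV[int]_n}).

(* An element of F_C(A) is its coefficient vector c : 'rV[R[i]]_#|{: A}|, and
   C : 'M_#|{: A}| is a matrix indexed by A; in both cases index k stands for
   the exponent [exponent k], the k-th element of A. *)
Definition exponent (k : 'I_#|{: A}|) : 'rV[int]_n := fsval (enum_val k).

Definition laurent (c : 'rV[R[i]]_#|{: A}|) (x : 'rV[R[i]]_n) : R[i] :=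
  \sum_k c ord0 k * \prod_j x ord0 j ^ exponent k ord0 j.

Definition posdef_mx m (M : 'M[R]_m) : Prop :=
  forall v : 'rV[R]_m, v != 0 -> 0 < (v *m M *m v^T) ord0 ord0.

Context (C : 'M[R]_#|{: A}|).

Definition pnorm (c : 'rV[R[i]]_#|{: A}|) : R :=
  Num.sqrt (\sum_k ComplexField.Normc.normc (c ord0 k) ^+ 2 / C k k).

Definition potential (p : 'rV[R]_n) : R :=
  2^-1 * ln (\sum_k C k k *
               expR (2 * \sum_j (exponent k ord0 j)%:~R * p ord0 j)).

Definition hessian (g : 'rV[R]_n -> R) (p : 'rV[R]_n) : 'M[R]_n :=
  \matrix_(j, k) 'D_(delta_mx ord0 j) ('D_(delta_mx ord0 k) g) p.

(* Tangent vectors are rows, so u^H H u reads conj(u) H u^T. *)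
Definition support_norm (p : 'rV[R]_n) (u : 'rV[R[i]]_n) : R :=
  Num.sqrt (complex.Re
    ((map_mx (@conjc R) u *m
      map_mx (real_complex R) (2^-1 *: hessian potential p) *m
      u^T) ord0 ord0)).

End OneSupport.

(* The product of the F_C(A_i), as block row vectors: f^i is submxrow f i. *)
Notation system R A := 'rV[R[i]]_(\sum_i #|{: A i}|).

Section Systems.
Context (R : realType) (n : nat) (A : 'I_n -> {fset 'rV[int]_n}).

Local Notation system := (system R A).

Definition component (f : system) (i : 'I_n) : 'rV[R[i]]_#|{: A i}| :=
  submxrow f i.

Definition sys_eval (f : system) (x : 'rV[R[i]]_n) : 'rV[R[i]]_n :=
  \row_i laurent (component f i) x.

Definition is_root (f : system) (w : 'rV[R[i]]_n) : Prop :=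
  sys_eval f (cexpv w) = 0.

(* [jacobian] is the transpose of the usual Jacobian matrix: same rank. *)
Definition jac_rank (f : system) (w : 'rV[R[i]]_n) : nat :=
  \rank (jacobian (sys_eval f) (cexpv w)).

Definition nondegenerate_root (f : system) (w : 'rV[R[i]]_n) : Prop :=
  is_root f w /\ jac_rank f w = n.

Definition degenerate_locus (w : 'rV[R[i]]_n) : set system :=
  [set g | is_root g w /\ (jac_rank g w < n)%N].

(* The branch of the implicit function through (f, w), lifted from the torus
   to C^n; its germ at f is determined by these conditions when w is a
   non-degenerate root of f. *)
Definition implicit_branch (f : system) (w : 'rV[R[i]]_n)
    (G : system -> 'rV[R[i]]_n) : Prop :=
  [/\ G f = w, \forall g \near f, is_root g (G g) & differentiable G f].

Context (C : forall i, 'M[R]_#|{: A i}|).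

Definition sys_norm (f : system) : R :=
  Num.sqrt (\sum_i pnorm (C i) (component f i) ^+ 2).

(* Norm of the tangent vector h at f in the product of the projective spaces
   P(F_C(A_i)): the norm sys_norm once every f^i is scaled to norm 1 (see
   tangent_norm_unit).  Like proj_dist it is invariant when f^i and h^i are
   multiplied by the same nonzero scalar; sys_norm itself is not, whereas the
   derivative at f of the implicit function is multiplied by 1/t when f is
   multiplied by t. *)
Definition tangent_norm (f h : system) : R :=
  Num.sqrt (\sum_i (pnorm (C i) (component h i) /
                    pnorm (C i) (component f i)) ^+ 2).

Lemma tangent_norm_unit (f h : system) :
  (forall i, pnorm (C i) (component f i) = 1) ->
  tangent_norm f h = sys_norm h.
Proof.
move=> f1; rewrite /tangent_norm /sys_norm; congr Num.sqrt.
by apply: eq_bigr => i _; rewrite f1 divr1.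
Qed.

Definition proj_dist (f g : system) : R :=
  Num.sqrt (\sum_i inf
    [set pnorm (C i) (component f i - l *: component g i) ^+ 2 /
         pnorm (C i) (component f i) ^+ 2 | l in [set l : R[i] | l != 0]]).

Definition proj_dist_set (f : system) (S : set system) : R :=
  inf [set proj_dist f g | g in S].

End Systems.

Arguments degenerate_locus {R n} A w.

(* Main.v *)
(* Put x = exp(p + iq), write f^i(exp w) = sum_a c_a e^(a.w) and let M be the
   derivative of w |-> (f^i(exp w))_i at p + iq; M is invertible.  Differentiating
   g(exp(G(g))) = 0 gives M (DG_f h) = - h(x), and by Cauchy-Schwarz h(x) runs over
   the ellipsoid sum_i |y_i|^2 / (kappa_i |f^i|^2) <= 1 when h runs over the unit
   ball, where kappa_i = sum_a C_aa e^(2a.p).  On the other hand g lies in the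
   degenerate locus iff, for some u <> 0, every g^i is annihilated by the two
   functionals "value at x" and "derivative at x along u".  Modulo the first one
   the second has squared dual norm kappa_i |u|_{A_i}^2, because the Hessian of
   g_{A_i} is twice the covariance matrix of the exponents under the probability
   weights C_aa e^(2a.p) / kappa_i.  Hence
     d_P(f, Sigma)^2 = inf_{u <> 0} sum_i |(M u)_i|^2 / (kappa_i |f^i|^2 |u|_{A_i}^2),
   and both inequalities follow by comparing each |u|_{A_i} with the extreme ones. *)
Require Import Defs.
From HB Require Import structures.
From mathcomp Require Import all_boot all_order all_algebra finmap.
From mathcomp Require Import all_classical all_reals all_analysis.
From mathcomp Require Import complex.
From mathcomp Require Import ring lra.

Set Implicit Arguments.
Unset Strict Implicit.
Unset Printing Implicit Defensive.

Import Order.TTheory GRing.Theory Num.Theory numFieldNormedType.Exports.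

Local Open Scope classical_set_scope.
Local Open Scope complex_scope.
Local Open Scope ring_scope.

Local Notation normc := ComplexField.Normc.normc.

(** * The complex exponential *)

(** Differentiability as an explicit remainder bound, the form in which the real estimates for
    [expR], [cos] and [sin] can be added up in [cexp_tangent]. *)
Lemma is_derive_tangent (R : realType) (g : R -> R) (x d e : R) :
  is_derive x 1 g d -> 0 < e ->
  \forall h \near 0, `|g (h + x) - g x - d * h| <= e * `|h|.
Proof.
move=> [/derivable_nbhsP /eqaddoP + <-] e0 => /(_ e e0).
apply: filter_app; near=> h => /=.
move=> H; apply: le_trans H; rewrite le_eqVlt; apply/orP; left; apply/eqP.
congr (`|_|); rewrite !fctE /= opprD addrA (_ : h%:A = h) ?[_ *: _]mulrC //.
by rewrite mul1r.
Unshelve. all: by end_near. Qed.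

Section ComplexExponential.
Context (R : realType).
Local Notation C := R[i].

Lemma cexpD (z w : C) : cexp (z + w) = cexp z * cexp w.
Proof.
case: z w => [a b] [c d]; rewrite /cexp /= expRD cosD sinD; simpc.
by congr (_ +i* _); ring.
Qed.

Lemma cexp0 : cexp (0 : C) = 1.
Proof. by rewrite /cexp /= expR0 cos0 sin0; simpc. Qed.

Lemma cexp_neq0 (z : C) : cexp z != 0.
Proof.
apply/eqP => z0; have := cexpD z (- z); rewrite z0 mul0r subrr cexp0.
by move/eqP; rewrite oner_eq0.
Qed.

Lemma normc_le_ReIm (z : C) : `|z| <= (`|complex.Re z| + `|complex.Im z|)%:C.
Proof.
rewrite {1}[z]complexE (le_trans (ler_normD _ _))// rmorphD/= lerD// ?normrM.
  by rewrite normc_def /= expr0n /= addr0 sqrtr_sqr.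
by rewrite !normc_def /= expr0n /= add0r addr0 !sqrtr_sqr normr1 mul1r.
Qed.

(** For h = a + ib, the real and imaginary parts of the remainder are bounded separately by
    multiples of |h|, through the tangent bounds of [expR] at a and of [cos] and [sin] at b. *)
Lemma cexp_tangent (e : R) : 0 < e ->
  \forall h \near (0 : C), `|cexp h - 1 - h| <= e%:C * `|h|.
Proof.
(* The 9 is 4 + 5, the numbers of terms [d * N] that [Re_le] and [Im_le] produce. The cap by 1
   yields |e^a - 1| <= 2|a| and, once |a| <= 1, |e^a| <= 3. *)
move=> e0; pose d := Num.min 1 (e / 9).
have d0 : 0 < d by rewrite lt_min ltr01 divr_gt0.
have d1 : d <= 1 by rewrite ge_min lexx.
have de : 9 * d <= e by rewrite mulrC -ler_pdivlMr// ge_min lexx orbT.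
move: d d0 d1 de => d d0 d1 de.
have /nbhs_norm0P[r1 /= r10 H1] := is_derive_tangent (is_derive_expR 0) d0.
have /nbhs_norm0P[r2 /= r20 H2] := is_derive_tangent (is_derive_cos 0) d0.
have /nbhs_norm0P[r3 /= r30 H3] := is_derive_tangent (is_derive_sin 0) d0.
pose r := Num.min (Num.min r1 r2) (Num.min r3 d).
have r0 : 0 < r by rewrite !lt_min r10 r20 r30 d0.
apply/nbhs_norm0P; exists r%:C; first by rewrite /= ltcR.
move=> [a b] /=.
have -> : `|a +i* b| = (Num.sqrt (a ^+ 2 + b ^+ 2))%:C by rewrite normc_def.
rewrite ltcR -rmorphM/=.
set N := Num.sqrt _.
have aN : `|a| <= N by rewrite -sqrtr_sqr ler_wsqrtr// lerDl sqr_ge0.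
have bN : `|b| <= N by rewrite -sqrtr_sqr ler_wsqrtr// lerDr sqr_ge0.
rewrite !lt_min => /andP[/andP[N1 N2] /andP[N3 N4]].
have /= := H1 a (le_lt_trans aN N1); rewrite addr0 expR0 mul1r => {}H1.
have /= := H2 b (le_lt_trans bN N2); rewrite addr0 cos0 sin0 oppr0 mul0r subr0 => {}H2.
have /= := H3 b (le_lt_trans bN N3); rewrite addr0 cos0 sin0 subr0 mul1r => {}H3.
apply: le_trans (normc_le_ReIm _) _; rewrite lecR /cexp /=; simpc => /=.
have a1 : `|a| <= 1 by rewrite (le_trans aN)// (le_trans (ltW N4)).
have ea : `|expR a - 1| <= 2 * `|a|.
  rewrite -[expR a - 1](subrK a) (le_trans (ler_normD _ _))//.
  rewrite [2 * _]mulrDl mul1r lerD2r (le_trans H1)// ler_piMl//.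

have ea3 : `|expR a| <= 3.
  rewrite -[expR a](subrK 1) (le_trans (ler_normD _ _))// normr1.
  by rewrite (le_trans (lerD ea (lexx _)))//; lra.
have N0 : 0 <= N by apply: sqrtr_ge0.
have Re_le : `|expR a * cos b - 1 - a| <= 3 * (d * N) + d * N.
  have -> : expR a * cos b - 1 - a = expR a * (cos b - 1) + (expR a - 1 - a) by ring.
  apply: le_trans (ler_normD _ _) _; rewrite normrM lerD//.
    by rewrite ler_pM// (le_trans H2)// ler_wpM2l// ltW.
  by rewrite (le_trans H1)// ler_wpM2l// ltW.
have Im_le : `|expR a * sin b - b| <= 3 * (d * N) + N * (2 * d).
  have -> : expR a * sin b - b = expR a * (sin b - b) + b * (expR a - 1) by ring.
  apply: le_trans (ler_normD _ _) _; rewrite !normrM lerD//.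
    by rewrite ler_pM// (le_trans H3)// ler_wpM2l// ltW.
  by rewrite ler_pM// (le_trans ea)// ler_wpM2l// (le_trans aN)// ltW.
apply: le_trans (lerD Re_le Im_le) _.
suff : 9 * d * N <= e * N by lra.
exact: ler_wpM2r.
Qed.

Lemma derive_cexp0 : is_derive (0 : C) 1 (@cexp R) 1.
Proof.
suff H : (fun h : C => h^-1 *: ((@cexp R \o shift 0) (h *: 1) - cexp 0))
    @ 0^' --> (1 : C).
  by apply: DeriveDef; [apply/cvg_ex; exists 1 | exact: cvg_lim].
apply/cvgrPdist_le => e e0.
have e'0 : 0 < complex.Re e by move: e0; rewrite ltcE /= => /andP[].
have eE : e = (complex.Re e)%:C by rewrite RRe_real// ger0_real// ltW.
have := cexp_tangent e'0; rewrite -eE => H.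
rewrite near_withinE; near=> h => h0.
rewrite /= addr0 cexp0 !(_ : forall z : C, h *: z = h * z) // mulr1.
have -> : 1 - h^-1 *: (cexp h - 1) = - (h^-1 * (cexp h - 1 - h)).
  by rewrite mulrBr mulVf// opprB.
rewrite normrN normrM normfV ler_pdivrMl ?normr_gt0// mulrC.
by near: h.
Unshelve. all: by end_near. Qed.

(** The functional equation cexp w = cexp z * cexp (w - z) carries the derivative at 0 to every
    point. *)
#[export] Instance is_diff_cexp (z : C) : is_diff z (@cexp R) ( *%R (cexp z)).
Proof.
have d0 : is_diff (0 : C) (@cexp R) id.
  have [dd dv] := derive_cexp0; have /derivable1_diffP df := dd.
  apply: DiffDef => //; rewrite deriv1E// derive1E dv.
  by apply/funext => h; exact: mulr1.
have -> : @cexp R = ( *:%R (cexp z)) \o @cexp R \o (fun w => w - z).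
  by apply/funext => w /=; rewrite [_ *: _]mulrC -cexpD subrK.
have ds : is_diff z (fun w : C => w - z) id.
  by apply: is_diff_eq; rewrite subr0.
have d0' : is_diff (z - z) (@cexp R) id by rewrite subrr.
by apply: is_diff_eq; apply/funext => h /=; rewrite subrr cexp0 [_ *: 1]mulr1.
Qed.

End ComplexExponential.

(** * Differentials of Laurent systems in logarithmic coordinates *)

Section LaurentDifferential.
Context (K : numFieldType).

(** The differential is kept in logarithmic form, f^a times a df/f: it is uniform in the sign of a,
    and for a product of powers the logarithmic terms simply add up. *)
#[export] Instance is_diff_exprz (V : normedModType K) (f df : V -> K) (x : V)
    (a : int) :
  f x != 0 -> is_diff x f df ->
  is_diff x (fun y => f y ^ a) (fun v => f x ^ a * (a%:~R * (df v / f x))).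
Proof.
move=> fx0 dfx.
have natX m : is_diff x (fun y => f y ^+ m) (fun v => f x ^+ m * (m%:R * (df v / f x))).
  case: m => [|m].
    have -> : (fun v => f x ^+ 0 * (0%:R * (df v / f x))) = 0.
      by apply/funext => v; rewrite mul0r mulr0.
    exact: is_diff_cst.
  have -> : (fun y => f y ^+ m.+1) = f ^+ m.+1 by apply/funext => y; rewrite exprfctE.
  apply: is_diff_eq; apply/funext => v /=.
  by rewrite -![(_ *: _) v]/(_ * _) exprS; field.
case: a => m; first exact: natX.
have fm0 : f x ^+ m.+1 != 0 by rewrite expf_neq0.
have [dm dv] := natX m.+1.
apply: DiffDef; first exact: differentiableV.
rewrite diffV// dv; apply/funext => v; rewrite NegzE -exprnN mulrNz.
change (- (f x ^+ m.+1) ^- 2 * (f x ^+ m.+1 * (m.+1%:R * (df v / f x))) =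
  f x ^- m.+1 * (- m.+1%:R * (df v / f x))).
by field; rewrite fx0 fm0.
Qed.

#[export] Instance is_diff_sumE n (V W : normedModType K) (f df : 'I_n -> V -> W)
    (x : V) :
  (forall i, is_diff x (f i) (df i)) ->
  is_diff x (fun y => \sum_i f i y) (fun v => \sum_i df i v).
Proof.
move=> dfx; rewrite -!fct_sumE.
by elim/big_ind2 : _ => // [|*]; [exact: is_diff_cst | exact: is_diffD].
Qed.

Lemma is_diff_prod_exprz (V : normedModType K) (I : Type) (r : seq I)
    (f df : I -> V -> K) (x : V) (a : I -> int) :
  (forall j, f j x != 0) -> (forall j, is_diff x (f j) (df j)) ->
  is_diff x (fun y => \prod_(j <- r) f j y ^ a j)
    (fun v => (\prod_(j <- r) f j x ^ a j) *
              \sum_(j <- r) (a j)%:~R * (df j v / f j x)).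
Proof.
move=> fx0 dfx; elim: r => [|j r ih].
  under eq_fun do rewrite big_nil.
  under [X in is_diff_def _ _ X]eq_fun do rewrite !big_nil mulr0.
  exact: is_diff_cst.
under eq_fun do rewrite big_cons.
have dj := is_diff_exprz (a j) (fx0 j) (dfx j).
apply: (is_diff_eq (is_diffM dj ih)); apply/funext => v.
rewrite -![(_ + _) v]/(_ + _) -![(_ *: _) v]/(_ * _) !big_cons; ring.
Qed.

End LaurentDifferential.

Section DiffRow.
Context (K : numFieldType) (V : normedModType K).

Lemma is_diff_scalelE (W : normedModType K) (f df : V -> K) (w : W) (x : V) :
  is_diff x f df -> is_diff x (fun y => f y *: w) (fun v => df v *: w).
Proof.
move=> dfx.
have -> : (fun y => f y *: w) = ( *:%R ^~ w) \o f by [].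
by apply: is_diff_eq.
Qed.

Lemma is_diff_row m (f df : 'I_m -> V -> K) (x : V) :
  (forall i, is_diff x (f i) (df i)) ->
  is_diff x (fun y => \row_i f i y) (fun v => \row_i df i v).
Proof.
move=> dfx.
have E (g : 'I_m -> V -> K) :
    (fun y => \row_i g i y) = (fun y => \sum_i g i y *: delta_mx (@ord0 0) i).
  apply/funext => y; rewrite [LHS]row_sum_delta.
  by apply: eq_bigr => i _; rewrite mxE.
rewrite !E; apply: is_diff_sumE => i; exact: is_diff_scalelE.
Qed.

Lemma is_diff_coord m n (M : 'M[K]_(m, n)) i j :
  is_diff M (fun N : 'M[K]_(m, n) => N i j : K) (fun N => N i j).
Proof.
(* The coordinate map packaged as a linear map, so that [diff_lin] makes it its own differential. *)
have @f : {linear 'M[K]_(m, n) -> K}.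
  by exists (fun N : 'M[K]_(_, _) => N i j); do 2![eexists]; do ?[constructor];
     rewrite ?mxE// => ? *; rewrite ?mxE//; move=> ?; rewrite !mxE.
apply: DiffDef; first exact: differentiable_coord.
by rewrite (_ : (fun _ => _) = f)// diff_lin//; exact: coord_continuous.
Qed.

End DiffRow.

Section LogCoordinates.
Context (R : realType) (n : nat).
Local Notation C := R[i].

Definition pairing (a : 'rV[int]_n) (u : 'rV[C]_n) : C :=
  \sum_j (a ord0 j)%:~R * u ord0 j.

Lemma cexp_sum (I : Type) (r : seq I) (F : I -> C) :
  cexp (\sum_(i <- r) F i) = \prod_(i <- r) cexp (F i).
Proof. by elim/big_ind2 : _ => [|z1 y1 z2 y2 <- <-|//]; rewrite ?cexp0 ?cexpD. Qed.

Lemma cexp_exprz (z : C) (a : int) : cexp (a%:~R * z) = cexp z ^ a.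
Proof.
have natX m : cexp (m%:R * z) = cexp z ^+ m.
  by elim: m => [|m ih]; rewrite ?mul0r ?cexp0 // mulrSr mulrDl mul1r cexpD ih exprSr.
case: a => m; first exact: natX.
rewrite NegzE -exprnN mulrNz mulNr -natX.
apply: (mulIf (cexp_neq0 (m.+1%:R * z))).
by rewrite -cexpD addNr cexp0 mulVf ?cexp_neq0.
Qed.

Lemma monomial_cexpv (a : 'rV[int]_n) (w : 'rV[C]_n) :
  \prod_j cexpv w ord0 j ^ a ord0 j = cexp (pairing a w).
Proof. by rewrite cexp_sum; apply: eq_bigr => j _; rewrite mxE cexp_exprz. Qed.

Lemma is_diff_pairing (V : normedModType C) (a : 'rV[int]_n)
    (f df : V -> 'rV[C]_n) (x : V) :
  is_diff x f df -> is_diff x (fun y => pairing a (f y)) (fun v => pairing a (df v)).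
Proof.
move=> dfx; apply: is_diff_sumE => j.
have dj : is_diff x (fun y => f y ord0 j) (fun v => df v ord0 j).
  have H := is_diff_coord (f x) ord0 j.
  exact: (is_diff_comp dfx H).
exact: (is_diffZ _ dj).
Qed.

Context (A : {fset 'rV[int]_n}).

(** The exponential sum obtained from a Laurent polynomial by the substitution x = exp w. *)
Definition log_eval (c : 'rV[C]_#|{: A}|) (w : 'rV[C]_n) : C :=
  \sum_k c ord0 k * cexp (pairing (exponent k) w).

(* The derivative of [log_eval c] at w in the direction u. *)
Definition log_deriv (c : 'rV[C]_#|{: A}|) (w u : 'rV[C]_n) : C :=
  \sum_k c ord0 k * (cexp (pairing (exponent k) w) * pairing (exponent k) u).

Lemma laurent_cexpv c w : laurent c (cexpv w) = log_eval c w.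
Proof. by apply: eq_bigr => k _; rewrite monomial_cexpv. Qed.

(** The vector with entries v_j / x_j is the tangent vector v read in the coordinates w = log x. *)
Lemma is_diff_laurent c (w : 'rV[C]_n) :
  is_diff (cexpv w) (laurent c)
    (fun v => log_deriv c w (\row_j (v ord0 j / cexpv w ord0 j))).
Proof.
apply: is_diff_sumE => k.
have /= H := @is_diff_prod_exprz _ _ _ (index_enum 'I_n) _ _ (cexpv w) (exponent k ord0)
  _ (fun j => is_diff_coord (cexpv w) ord0 j).
have {}H := H (fun j => ltac:(rewrite mxE; exact: cexp_neq0)).
apply: (is_diff_eq (is_diffZ (c ord0 k) H)); apply/funext => v.
rewrite -![(_ *: _) v]/(_ * _) monomial_cexpv; congr (_ * (_ * _)).
by apply: eq_bigr => j _; rewrite !mxE.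
Qed.

End LogCoordinates.

Section SystemDifferential.
Context (R : realType) (n : nat) (A : 'I_n -> {fset 'rV[int]_n}).
Local Notation C := R[i].
Local Notation system := 'rV[C]_(\sum_i #|{: A i}|).

Lemma is_rootP (g : system) (w : 'rV[C]_n) :
  is_root g w <-> forall i, log_eval (component g i) w = 0.
Proof.
split=> [/rowP g0 i|g0]; first by have := g0 i; rewrite !mxE laurent_cexpv.
by apply/rowP => i; rewrite !mxE laurent_cexpv.
Qed.

Lemma is_diff_sys_eval (g : system) (w : 'rV[C]_n) :
  is_diff (cexpv w) (sys_eval g) (fun v => \row_i log_deriv (component g i) w
    (\row_j (v ord0 j / cexpv w ord0 j))).
Proof. by apply: is_diff_row => i; exact: is_diff_laurent. Qed.

Lemma jacobian_cexpv (g : system) (w v : 'rV[C]_n) :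
  v *m jacobian (sys_eval g) (cexpv w) =
  \row_i log_deriv (component g i) w (\row_j (v ord0 j / cexpv w ord0 j)).
Proof.
have [dg dgE] := is_diff_sys_eval g w.
by rewrite -deriveEjacobian// deriveE// dgE.
Qed.

Lemma cexpv_neq0 (w : 'rV[C]_n) j : cexpv w ord0 j != 0.
Proof. by rewrite mxE cexp_neq0. Qed.

(** Multiplying coordinatewise by x = exp w, whose entries are nonzero, maps the common kernel of
    the logarithmic derivatives isomorphically onto the kernel of the Jacobian. *)
Lemma jac_rank_ltP (g : system) (w : 'rV[C]_n) :
  (jac_rank g w < n)%N <->
  exists2 u : 'rV[C]_n, u != 0 & forall i, log_deriv (component g i) w u = 0.
Proof.
rewrite ltn_neqAle rank_leq_row andbT -/(row_free _).
split.
  rewrite -kermx_eq0 => /rowV0Pn[v vker v0].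
  exists (\row_j (v ord0 j / cexpv w ord0 j)).
    apply: contra v0 => /eqP /rowP u0; apply/eqP/rowP => j.
    have /eqP := u0 j.
    by rewrite !mxE mulf_eq0 invr_eq0 (negPf (cexp_neq0 _)) orbF => /eqP.
  move=> i; have /rowP /(_ i) := jacobian_cexpv g w v.
  by rewrite (sub_kermxP vker) !mxE.
move=> [u u0 gu]; rewrite -kermx_eq0; apply/rowV0Pn.
exists (\row_j (u ord0 j * cexpv w ord0 j)).
  apply/sub_kermxP; rewrite jacobian_cexpv; apply/rowP => i; rewrite !mxE.
  rewrite -[RHS](gu i); congr log_deriv; apply/rowP => j.
  by rewrite !mxE mulfK ?cexp_neq0.
apply: contra u0 => /eqP /rowP u0; apply/eqP/rowP => j.
by have /eqP := u0 j; rewrite !mxE mulf_eq0 (negPf (cexp_neq0 _)) orbF => /eqP.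
Qed.

Lemma is_diff_component (f : system) i k :
  is_diff f (fun g : system => component g i ord0 k) (fun h => component h i ord0 k).
Proof.
have E : (fun g : system => component g i ord0 k) = (fun g => g ord0 (tagnat.Rank i k)).
  by apply/funext => g; rewrite !mxE.
by rewrite E; exact: is_diff_coord.
Qed.

(** The left-hand side is the differential at f of g |-> g^i(exp(G g)): the first term comes from
    varying the coefficients, the second from moving the root. That function vanishes near f. *)
Lemma implicit_diff (f : system) (w : 'rV[C]_n) (G : system -> 'rV[C]_n) :
  implicit_branch f w G -> forall h i,
  log_eval (component h i) w + log_deriv (component f i) w ('d G f h) = 0.
Proof.
move=> [Gf Groot /differentiableP dG] h i.
have dH : is_diff f (fun g => log_eval (component g i) (G g))
    (fun h => log_eval (component h i) w + log_deriv (component f i) w ('d G f h)).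
  have dk (k : 'I_#|{: A i}|) : is_diff f
      (fun g => component g i ord0 k * cexp (pairing (exponent k) (G g)))
      (fun h => component f i ord0 k *
         (cexp (pairing (exponent k) w) * pairing (exponent k) ('d G f h)) +
         component h i ord0 k * cexp (pairing (exponent k) w)).
    have d1 := is_diff_comp (is_diff_pairing (exponent k) dG) (is_diff_cexp _).
    have dM := is_diffM (is_diff_component f k) d1.
    apply: (is_diff_eq dM).

    apply/funext => v; rewrite -![(_ + _) v]/(_ + _) -![(_ *: _) v]/(_ * _) /= Gf.
    by rewrite [X in _ + X]mulrC.
  have dS := is_diff_sumE dk; apply: is_diff_eq; apply/funext => v.
  by rewrite big_split /= addrC.
have [dd dE] := dH.
rewrite -[LHS]/((fun h => log_eval (component h i) w +
   log_deriv (component f i) w ('d G f h)) h) -dE -deriveE//.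
rewrite (near_eq_derive (g := cst 0)) ?derive_cst//.
by apply: filterS Groot => g /is_rootP.
Qed.

End SystemDifferential.

(** * The Hessian of the potential as a covariance matrix *)

#[export] Instance is_diff_expR (R : realType) (x : R) :
  is_diff x (@expR R) ( *%R (expR x)).
Proof.
have [dd dv] := is_derive_expR x; have /derivable1_diffP df := dd.
apply: DiffDef => //; rewrite deriv1E// derive1E dv.
by apply/funext => h; exact: mulrC.
Qed.

Lemma is_diff_ln (R : realType) (x : R) : 0 < x -> is_diff x (@ln R) ( *%R x^-1).
Proof.
move=> x0; have [dd dv] := is_derive1_ln x0; have /derivable1_diffP df := dd.
apply: DiffDef => //; rewrite deriv1E// derive1E dv.
by apply/funext => h; exact: mulrC.
Qed.

Lemma diag_posdef_gt0 (R : realType) m (M : 'M[R]_m) :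
  posdef_mx M -> forall k, 0 < M k k.
Proof.
move=> Mpos k; have /Mpos : delta_mx ord0 k != 0 :> 'rV[R]_m.
  by apply/eqP => /rowP /(_ k) /eqP; rewrite !mxE !eqxx oner_eq0.
by rewrite -rowE trmx_delta -colE !mxE.
Qed.

Section Potential.
Context (R : realType) (n : nat) (A : {fset 'rV[int]_n}) (C : 'M[R]_#|{: A}|).
Hypothesis C_gt0 : forall k, 0 < C k k.
(** An index witnesses that the support is nonempty, which makes [weight_sum] positive. *)
Variable k0 : 'I_#|{: A}|.
Implicit Types (p : 'rV[R]_n) (k : 'I_#|{: A}|).

Definition expo k j : R := (exponent k ord0 j)%:~R.

(** Unnormalized probability weights on the exponents. Their total [weight_sum] is kappa, and the
    expectation [weight_mean] of the exponent is the gradient of the potential. *)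
Definition weight p k : R := C k k * expR (2 * \sum_j expo k j * p ord0 j).

Definition weight_sum p : R := \sum_k weight p k.

Definition weight_mean p j : R := (\sum_k weight p k * expo k j) / weight_sum p.

Lemma weight_gt0 p k : 0 < weight p k.
Proof. by rewrite mulr_gt0// expR_gt0. Qed.

Lemma weight_sum_gt0 p : 0 < weight_sum p.
Proof.
rewrite /weight_sum (bigD1 k0)//= ltr_pwDl ?weight_gt0//.
by rewrite sumr_ge0// => k _; rewrite ltW// weight_gt0.
Qed.

Lemma is_diff_weight p k :
  is_diff p (weight^~ k) (fun v => weight p k * (2 * \sum_j expo k j * v ord0 j)).
Proof.
have dl : is_diff p (fun p => \sum_j expo k j * p ord0 j)
                    (fun v => \sum_j expo k j * v ord0 j).
  by apply: is_diff_sumE => j; exact: (is_diffZ (expo k j) (is_diff_coord p ord0 j)).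
have d1 := is_diff_comp (is_diffZ 2 dl) (is_diff_expR _).
apply: (is_diff_eq (is_diffZ (C k k) d1)); apply/funext => v.
exact: mulrA.
Qed.

Lemma is_diff_weight_sum p :
  is_diff p weight_sum (fun v => \sum_k weight p k * (2 * \sum_j expo k j * v ord0 j)).
Proof. by apply: is_diff_sumE => k; exact: is_diff_weight. Qed.

Lemma sum_expo_delta k j :
  \sum_i expo k i * (delta_mx ord0 j : 'rV[R]_n) ord0 i = expo k j.
Proof.
rewrite (bigD1 j)//= mxE !eqxx mulr1 big1 ?addr0// => i /negPf ij.
by rewrite mxE ij mulr0.
Qed.

Lemma derive_potential j : 'D_(delta_mx ord0 j) (potential C) = weight_mean^~ j.
Proof.
apply/funext => p.
have dp := is_diffZ 2^-1
  (is_diff_comp (is_diff_weight_sum p) (is_diff_ln (weight_sum_gt0 p))).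
have -> : potential C = 2^-1 *: (@ln R \o weight_sum) by [].
have [dd dE] := dp; rewrite deriveE// dE -![(_ *: _) _]/(_ * _) /=.
under eq_bigr do rewrite sum_expo_delta.
rewrite mulrCA mulrC; congr (_ / _); rewrite mulr_sumr; apply: eq_bigr => k _.
by rewrite mulrCA mulKf.
Qed.

(** The quotient rule applied to the mean of a_j gives 2 (E[a_i a_j] - E[a_i] E[a_j]); the factor
    1/2 leaves the covariance. *)
Lemma hessian_potential p :
  2^-1 *: hessian (potential C) p = \matrix_(i, j) \sum_k weight p k / weight_sum p *
    ((expo k i - weight_mean p i) * (expo k j - weight_mean p j)).
Proof.
apply/matrixP => i j; rewrite !mxE derive_potential.
have T0 := weight_sum_gt0 p.
have dN : is_diff p (fun p => \sum_k weight p k * expo k j)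
    (fun v => \sum_k (weight p k * (2 * \sum_i expo k i * v ord0 i)) * expo k j).
  apply: is_diff_sumE => k.
  have -> : (fun y => weight y k * expo k j) = expo k j *: (weight^~ k).
    by apply/funext => y; exact: mulrC.
  apply: (is_diff_eq (is_diffZ _ (is_diff_weight p k))); apply/funext => v.
  exact: mulrC.
have dV := is_diff_exprz (-1) (lt0r_neq0 T0) (is_diff_weight_sum p).
have -> : weight_mean^~ j =
    (fun p => \sum_k weight p k * expo k j) * (fun p => weight_sum p ^ (-1)).
  by [].
have [dd dE] := is_diffM dN dV; rewrite deriveE// dE.
rewrite -![(_ + _) (delta_mx _ _)]/(_ + _) -![(_ *: _) (delta_mx _ _)]/(_ * _).
have -> : \sum_k weight p k * (2 * \sum_l expo k l * (delta_mx ord0 i : 'rV[R]_n) ord0 l)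
    = 2 * (weight_mean p i * weight_sum p).
  rewrite divfK ?lt0r_neq0// mulr_sumr; apply: eq_bigr => k _.
  by rewrite sum_expo_delta mulrCA.
have -> : \sum_k weight p k * (2 * \sum_l expo k l * (delta_mx ord0 i : 'rV[R]_n) ord0 l)
     * expo k j = 2 * \sum_k weight p k * (expo k i * expo k j).
  rewrite mulr_sumr; apply: eq_bigr => k _.
  by rewrite sum_expo_delta; ring.
rewrite [(fun p => \sum_k weight p k * expo k j) p]
  (_ : _ = weight_mean p j * weight_sum p); last first.
  by rewrite divfK ?lt0r_neq0.
rewrite exprN1 mulrN1z.
(* The product of the two centered exponents is expanded, so that each of the four sums becomes a
   moment. *)
transitivity (\sum_k ((weight p k * (expo k i * expo k j)) / weight_sum p
   - weight_mean p j * (weight p k * expo k i / weight_sum p)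
   - weight_mean p i * (weight p k * expo k j / weight_sum p)
   + weight_mean p i * weight_mean p j * (weight p k / weight_sum p))); last first.
  by apply: eq_bigr => k _; ring.
rewrite big_split !sumrB /= -!mulr_sumr -!mulr_suml.
rewrite -/(weight_sum p) -/(weight_mean p i) -/(weight_mean p j).
rewrite divff ?lt0r_neq0//.
by field; rewrite lt0r_neq0.
Qed.

End Potential.

(** * Moduli and conjugates of complex numbers *)

Section Normc.
Context (R : realType).
Local Notation C := R[i].

Lemma sqr_normcE (z : C) : ((normc z) ^+ 2)%:C = z * z^*%C.
Proof. by rewrite -sqr_normc rmorphXn/=; congr (_ ^+ 2); rewrite normc_def; case: z. Qed.

Lemma normc_conj (z : C) : normc z^*%C = normc z.
Proof. by case: z => a b /=; rewrite sqrrN. Qed.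

Lemma normc_real (x : R) : normc x%:C = `|x|.
Proof. by rewrite /= expr0n addr0 sqrtr_sqr. Qed.

Lemma normc_ge0 (z : C) : 0 <= normc z.
Proof. by case: z => a b /=; rewrite sqrtr_ge0. Qed.

Lemma normc_eq0 (z : C) : (normc z == 0) = (z == 0).
Proof.
apply/eqP/eqP => [|->]; first exact: ComplexField.Normc.eq0_normc.
exact: ComplexField.Normc.normc0.
Qed.

Lemma conjc_sum (I : Type) (r : seq I) (F : I -> C) :
  (\sum_(i <- r) F i)^*%C = \sum_(i <- r) (F i)^*%C.
Proof. exact: rmorph_sum. Qed.

Lemma real_complex_sum (I : Type) (r : seq I) (F : I -> R) :
  (\sum_(i <- r) F i)%:C = \sum_(i <- r) (F i)%:C :> C.
Proof. exact: rmorph_sum. Qed.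

Lemma real_complexB (x y : R) : (x - y)%:C = x%:C - y%:C :> C.
Proof. exact: rmorphB. Qed.

Lemma real_complexD (x y : R) : (x + y)%:C = x%:C + y%:C :> C.
Proof. exact: rmorphD. Qed.

Lemma real_complexM (x y : R) : (x * y)%:C = x%:C * y%:C :> C.
Proof. exact: rmorphM. Qed.

Lemma real_complexV (x : R) : (x^-1)%:C = x%:C^-1 :> C.
Proof. exact: fmorphV. Qed.

Lemma conjcM (x y : C) : (x * y)^*%C = x^*%C * y^*%C.
Proof. exact: rmorphM. Qed.

Lemma conjcB (x y : C) : (x - y)^*%C = x^*%C - y^*%C.
Proof. exact: rmorphB. Qed.

Lemma normc_cexp (z : C) : normc (cexp z) = expR (complex.Re z).
Proof.
rewrite /cexp ComplexField.Normc.normcM normc_real /= cos2Dsin2 sqrtr1 mulr1.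
by rewrite ger0_norm// expR_ge0.
Qed.

End Normc.

(** * The support norm as a standard deviation *)

Section SupportNorm.
Context (R : realType) (n : nat) (A : {fset 'rV[int]_n}) (C : 'M[R]_#|{: A}|).
Hypothesis C_gt0 : forall k, 0 < C k k.
Variable k0 : 'I_#|{: A}|.

(** The difference between a.u and its mean under the weights, for a the k-th exponent. *)
Definition deviation (p : 'rV[R]_n) (u : 'rV[R[i]]_n) (k : 'I_#|{: A}|) : R[i] :=
  \sum_j (expo R k j - weight_mean C p j)%:C * u ord0 j.

(** The covariance matrix is a weighted sum of rank-one matrices, so its Hermitian form at u is the
    variance of a.u. *)
Lemma support_norm_sqr p u :
  support_norm C p u ^+ 2 =
  \sum_k weight C p k / weight_sum C p * normc (deviation p u k) ^+ 2.
Proof.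
have T0 := weight_sum_gt0 C_gt0 k0 p.
have S0 : 0 <= \sum_k weight C p k / weight_sum C p * normc (deviation p u k) ^+ 2.
  apply: sumr_ge0 => k _; rewrite mulr_ge0 ?sqr_ge0// divr_ge0// ltW//.
  exact: weight_gt0.
rewrite /support_norm hessian_potential//.
set M := (_ *m _ *m _) _ _.
suff -> : M = (\sum_k weight C p k / weight_sum C p * normc (deviation p u k) ^+ 2)%:C.
  by rewrite /= sqr_sqrtr.
rewrite {}/M mxE real_complex_sum.
under eq_bigr => j _.
  rewrite mxE mulr_suml.
  under eq_bigr => i _ do
    rewrite !mxE rmorph_sum/= mulr_sumr mulr_suml.
  rewrite exchange_big /=.
  over.
rewrite exchange_big /=; apply: eq_bigr => k _.
rewrite [RHS]rmorphM/= sqr_normcE.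
have -> : (deviation p u k)^*%C =
    \sum_i (expo R k i - weight_mean C p i)%:C * (u ord0 i)^*%C.
  rewrite conjc_sum; apply: eq_bigr => i _.
  by rewrite rmorphM; congr (_ * _); exact: conjc_real.
rewrite /deviation mulr_suml mulr_sumr; apply: eq_bigr => j _.
rewrite !mulr_sumr; apply: eq_bigr => i _.
rewrite [X in _ * X * _ = _]rmorphM [X in _ * (_ * X) * _ = _]rmorphM /=.
ring.
Qed.
End SupportNorm.

(** * Weighted duality and distances to linear conditions *)

Section WeightedDuality.
Context (R : realType) (m : nat) (c : 'I_m -> R).
Hypothesis c_gt0 : forall k, 0 < c k.
Local Notation C := R[i].
Implicit Types h v : 'I_m -> C.

(** [P] is the squared norm of vectors, as in [pnorm], and [Q v] the squared dual norm of the
    functional h |-> sum_k h_k v_k. *)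
Let P h : R := \sum_k normc (h k) ^+ 2 / c k.
Let Q v : R := \sum_k c k * normc (v k) ^+ 2.

(* The functional h |-> \sum_k h k * v k takes the value z at this vector, which
   has the least norm among the vectors where it does. *)
Definition representer v (z : C) (k : 'I_m) : C :=
  z / (Q v)%:C * ((c k)%:C * (v k)^*%C).

Lemma dual_norm_ge0 v : 0 <= Q v.
Proof. by apply: sumr_ge0 => k _; rewrite mulr_ge0 ?sqr_ge0// ltW. Qed.

Lemma dual_norm_eq0 v : Q v = 0 -> forall k, v k = 0.
Proof.
move=> Q0 k.
have H i : true -> 0 <= c i * normc (v i) ^+ 2.
  by move=> _; rewrite mulr_ge0 ?sqr_ge0// ltW.
have : c k * normc (v k) ^+ 2 = 0 by exact: (psumr_eq0P H Q0).
by move/eqP; rewrite mulf_eq0 gt_eqF//= sqrf_eq0 normc_eq0 => /eqP.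
Qed.

Lemma representer_dual v (z : C) (u : 'I_m -> C) :
  \sum_k representer v z k * u k =
  z / (Q v)%:C * \sum_k (c k)%:C * (v k)^*%C * u k.
Proof. by rewrite mulr_sumr; apply: eq_bigr => k _; rewrite mulrA. Qed.

Lemma dual_normE v : (Q v)%:C = \sum_k (c k)%:C * (v k)^*%C * v k.
Proof.
rewrite real_complex_sum; apply: eq_bigr => k _.
by rewrite rmorphM/= sqr_normcE -mulrA [_^*%C * _]mulrC.
Qed.

Lemma representer_eval v (z : C) : Q v != 0 -> \sum_k representer v z k * v k = z.
Proof.
move=> Q0; rewrite representer_dual -dual_normE divfK//.
by rewrite (_ : 0 = 0%:C)// (inj_eq (@complexI R)).
Qed.

Lemma representer_norm v (z : C) : P (representer v z) = normc z ^+ 2 / Q v.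
Proof.
have [Q0|Q0] := eqVneq (Q v) 0.
  (* Division by zero returns 0, so that both sides vanish here. *)
  rewrite Q0 invr0 mulr0 /P big1// => k _.
  rewrite /representer Q0 invr0 mulr0 mul0r.
  by rewrite ComplexField.Normc.normc0 expr0n mul0r.
rewrite -[RHS]mulr1 -[X in _ * X](divff Q0) {3}/Q mulr_suml mulr_sumr.
apply: eq_bigr => k _; rewrite !ComplexField.Normc.normcM ComplexField.Normc.normcV.
rewrite !normc_real normc_conj (gtr0_norm (c_gt0 k)) (ger0_norm (dual_norm_ge0 v)).
rewrite -/(Q v); move: (Q v) Q0 => q q0; have ck0 := lt0r_neq0 (c_gt0 k).
by field; rewrite q0 ck0.
Qed.

Lemma representer_conj v (z : C) k :
  (representer v z k)^*%C = z^*%C / (Q v)%:C * ((c k)%:C * v k).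
Proof.
by rewrite /representer !conjcM conjcK conjc_inv !conjc_real.
Qed.

(** Pythagoras: if S is the value of the functional at h, then h minus [representer v S] is
    orthogonal to the representer, and its squared norm is the defect P h - |S|^2 / Q v. *)
Lemma weighted_cauchy h v : normc (\sum_k h k * v k) ^+ 2 <= P h * Q v.
Proof.
have [Q0|Q0] := eqVneq (Q v) 0.
  rewrite Q0 mulr0 big1 ?ComplexField.Normc.normc0 ?expr0n// => k _.
  by rewrite (dual_norm_eq0 Q0) mulr0.
have Qp : 0 < Q v by rewrite lt_neqAle eq_sym Q0 dual_norm_ge0.
set S := \sum_k _; rewrite -ler_pdivrMr// -subr_ge0.
suff -> : P h - normc S ^+ 2 / Q v = P (fun k => h k - representer v S k).
  by apply: sumr_ge0 => k _; rewrite divr_ge0 ?sqr_ge0// ltW.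
have QC : (Q v)%:C != 0 by rewrite (_ : 0 = 0%:C)// (inj_eq (@complexI R)).
have crossE : \sum_k h k * (representer v S k)^*%C / (c k)%:C = S * S^*%C / (Q v)%:C.
  rewrite {2}/S !mulr_suml; apply: eq_bigr => k _.
  have cC : (c k)%:C != 0 by rewrite (_ : 0 = 0%:C)// (inj_eq (@complexI R)) gt_eqF.
  rewrite representer_conj.
  by field; rewrite cC QC.
have crossE' : \sum_k (h k)^*%C * representer v S k / (c k)%:C = S * S^*%C / (Q v)%:C.
  rewrite {3}/S conjc_sum mulr_sumr !mulr_suml; apply: eq_bigr => k _.
  have cC : (c k)%:C != 0 by rewrite (_ : 0 = 0%:C)// (inj_eq (@complexI R)) gt_eqF.
  rewrite /representer conjcM.
  by field; rewrite cC QC.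
(* The bracket is the sum of the two cross terms, each equal to |S|^2 / Q v, which is also the
   squared norm of the representer. *)
have -> : P (fun k => h k - representer v S k) =
    P (fun k => h k) + P (representer v S)
    - (P h + P (representer v S) - P (fun k => h k - representer v S k)) by ring.
rewrite representer_norm.
have -> : (P h + normc S ^+ 2 / Q v - P (fun k => h k - representer v S k)) =
   2 * (normc S ^+ 2 / Q v); last by ring.
apply: (@complexI R); rewrite -representer_norm.
transitivity (\sum_k (h k * (representer v S k)^*%C / (c k)%:C
    + (h k)^*%C * representer v S k / (c k)%:C)).
  rewrite real_complexB real_complexD /P !real_complex_sum -big_split -sumrB.
  apply: eq_bigr => k _ /=.
  by rewrite ![(_ / _)%:C]real_complexM !real_complexV !sqr_normcE conjcB; ring.
rewrite big_split /= crossE crossE' representer_norm real_complexM.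
rewrite [(_ / _)%:C]real_complexM.
rewrite real_complexV sqr_normcE.
by rewrite -[2]/(1 + 1) real_complexD mulrDl [1%:C * _]mul1r.
Qed.

(** Vectors orthogonal to v do not see a constant added to d. This removes the mean of a.u from the
    derivative of a polynomial that vanishes at the point. *)
Lemma sum_shift h v (d : 'I_m -> C) (mu : C) : \sum_k h k * v k = 0 ->
  \sum_k h k * (v k * (d k + mu)) = \sum_k h k * (v k * d k).
Proof.
move=> hv; transitivity (\sum_k h k * (v k * d k) + mu * \sum_k h k * v k).
  by rewrite mulr_sumr -big_split; apply: eq_bigr => k _ /=; ring.
by rewrite hv mulr0 addr0.
Qed.

(* In the next two lemmas the vectors orthogonal to v and to v * (d + mu) form the
   subspace L; since v * d is dual-orthogonal to v, the functional v * d alone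
   measures the distance from f to L. *)
Lemma distance_ge (f g v d : 'I_m -> C) (mu l : C) :
  \sum_k f k * v k = 0 -> \sum_k g k * v k = 0 ->
  \sum_k g k * (v k * (d k + mu)) = 0 ->
  normc (\sum_k f k * (v k * (d k + mu))) ^+ 2 <=
  P (fun k => f k - l * g k) * Q (fun k => v k * d k).
Proof.
move=> fv gv gl; apply: le_trans (weighted_cauchy _ _).
rewrite le_eqVlt; apply/orP; left; apply/eqP; congr (normc _ ^+ 2).
rewrite (sum_shift d mu fv); rewrite (sum_shift d mu gv) in gl.
transitivity (\sum_k f k * (v k * d k) - l * \sum_k g k * (v k * d k)).
  by rewrite gl mulr0 subr0.
by rewrite mulr_sumr -sumrB; apply: eq_bigr => k _; ring.
Qed.

Lemma distance_attained (f v d : 'I_m -> C) (mu : C) :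
  \sum_k f k * v k = 0 ->
  \sum_k (c k)%:C * (v k * d k)^*%C * v k = 0 ->
  exists2 g : 'I_m -> C,
    \sum_k g k * v k = 0 /\ \sum_k g k * (v k * (d k + mu)) = 0 &
    P (fun k => f k - g k) =
      normc (\sum_k f k * (v k * (d k + mu))) ^+ 2 / Q (fun k => v k * d k).
Proof.
move=> fv vd; set z := \sum_k _ * (_ * (_ + _)).
pose h := representer (fun k => v k * d k) z.
have hv : \sum_k h k * v k = 0 by rewrite representer_dual vd mulr0.
exists (fun k => f k - h k); last first.
  by rewrite -representer_norm; apply: eq_bigr => k _; rewrite opprB addrC subrK.
split.
  under eq_bigr do rewrite mulrBl.
  by rewrite sumrB fv hv subr0.
under eq_bigr do rewrite mulrBl.
rewrite sumrB -/z.
rewrite (sum_shift d mu hv).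
have [Q0|Q0] := eqVneq (Q (fun k => v k * d k)) 0; last first.
  by rewrite representer_eval ?subrr.
(* If v * d has dual norm zero, the representer vanishes and f itself must satisfy both conditions;
   [distance_ge] against the zero vector shows this. *)
have zE : z = 0.
  have := @distance_ge f (fun=> 0) v d mu 0 fv; rewrite Q0 mulr0.
  have s0 (u : 'I_m -> C) : \sum_k (fun=> 0) k * u k = 0.
    by rewrite big1// => k _; rewrite mul0r.
  move=> /(_ (s0 _) (s0 _)).
  by rewrite -/z -[_ <= 0]andbT -(sqr_ge0 (normc z)) -eq_le sqrf_eq0 normc_eq0 => /eqP.
rewrite zE sub0r big1 ?oppr0// => k _.
by rewrite (dual_norm_eq0 Q0) mulr0.
Qed.

End WeightedDuality.

Lemma Re_sum (R : realType) (I : Type) (r : seq I) (F : I -> R[i]) :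
  complex.Re (\sum_(i <- r) F i) = \sum_(i <- r) complex.Re (F i).
Proof. by apply: (big_morph (@complex.Re R)) => // -[a b] [c d]. Qed.

(** * Value and derivative functionals for a single support *)

Section OneSupport.
Context (R : realType) (n : nat) (A : {fset 'rV[int]_n}) (C : 'M[R]_#|{: A}|).
Hypothesis C_gt0 : forall k, 0 < C k k.
Variable k0 : 'I_#|{: A}|.
Context (p q : 'rV[R]_n).
Local Notation w := (torus_point p q).
Local Notation kappa := (weight_sum C p).
Implicit Types (c f g : 'rV[R[i]]_#|{: A}|) (u : 'rV[R[i]]_n) (k : 'I_#|{: A}|).

Lemma pnorm_sqr c : pnorm C c ^+ 2 = \sum_k normc (c ord0 k) ^+ 2 / C k k.
Proof.
by rewrite sqr_sqrtr// sumr_ge0// => k _; rewrite divr_ge0 ?sqr_ge0// ltW.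
Qed.

Lemma pairing_expo k u : pairing (exponent k) u = \sum_j (expo R k j)%:C * u ord0 j.
Proof.
apply: eq_bigr => j _; congr (_ * _).
by rewrite /expo (rmorph_int (real_complex R)).
Qed.

Lemma weightE k :
  weight C p k = C k k * normc (cexp (pairing (exponent k) w)) ^+ 2.
Proof.
rewrite normc_cexp -expRM_natl; congr (_ * expR (_ * _)).
rewrite pairing_expo Re_sum; apply: eq_bigr => j _.
by rewrite mxE /= mul0r subr0.
Qed.

Lemma weight_sumE :
  kappa = \sum_k C k k * normc (cexp (pairing (exponent k) w)) ^+ 2.
Proof. by apply: eq_bigr => k _; rewrite weightE. Qed.

(** The mean of a.u, which plays the role of mu in [sum_shift]. *)
Definition center u : R[i] := \sum_j (weight_mean C p j)%:C * u ord0 j.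

Lemma pairing_deviation k u : pairing (exponent k) u = deviation C p u k + center u.
Proof.
rewrite pairing_expo -big_split; apply: eq_bigr => j _ /=.
by rewrite -mulrDl -real_complexD subrK.
Qed.

Lemma deviation_dual_norm u :
  \sum_k C k k * normc (cexp (pairing (exponent k) w) * deviation C p u k) ^+ 2
  = kappa * support_norm C p u ^+ 2.
Proof.
rewrite (support_norm_sqr C_gt0 k0) mulr_sumr; apply: eq_bigr => k _.
have -> : C k k * normc (cexp (pairing (exponent k) w) * deviation C p u k) ^+ 2 =
    weight C p k * normc (deviation C p u k) ^+ 2.
  by rewrite weightE ComplexField.Normc.normcM; ring.
by field; rewrite lt0r_neq0// (weight_sum_gt0 C_gt0 k0).
Qed.

(** Up to conjugation this is the weighted sum of deviations from the mean. It is the orthogonality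
    that [distance_attained] requires. *)
Lemma deviation_orthogonal u :
  \sum_k (C k k)%:C * (cexp (pairing (exponent k) w) * deviation C p u k)^*%C
    * cexp (pairing (exponent k) w) = 0.
Proof.
transitivity ((\sum_k (weight C p k)%:C * deviation C p u k)^*%C).
  rewrite conjc_sum; apply: eq_bigr => k _.
  rewrite weightE real_complexM sqr_normcE.
  move: (cexp _) (C k k)%:C (conjc_real (C k k)).
  by move=> x c cr; rewrite !conjcM conjcK cr; ring.
rewrite [X in X^*%C](_ : _ = 0) ?conjc0//.
under eq_bigr do rewrite mulr_sumr.
rewrite exchange_big big1// => j _.
under eq_bigr do rewrite mulrA -real_complexM.
rewrite -mulr_suml -real_complex_sum.
rewrite [X in X%:C](_ : _ = 0) ?mul0r//.
under eq_bigr do rewrite mulrBr.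
rewrite sumrB -mulr_suml -/(weight_sum C p) mulrC.
by rewrite divfK ?subrr// lt0r_neq0// (weight_sum_gt0 C_gt0 k0).
Qed.

Lemma eval_bound c : normc (log_eval c w) ^+ 2 <= pnorm C c ^+ 2 * kappa.
Proof. by rewrite pnorm_sqr weight_sumE; exact: weighted_cauchy. Qed.

Lemma eval_attained (z : R[i]) :
  exists2 c, log_eval c w = z & pnorm C c ^+ 2 = normc z ^+ 2 / kappa.
Proof.
pose h := representer (fun k => C k k) (fun k => cexp (pairing (exponent k) w)) z.
exists (\row_k h k).
  rewrite /log_eval; under eq_bigr do rewrite mxE.
  by rewrite representer_eval// -weight_sumE lt0r_neq0// (weight_sum_gt0 C_gt0 k0).
rewrite pnorm_sqr; under eq_bigr do rewrite mxE.
by rewrite representer_norm// weight_sumE.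
Qed.

Lemma log_deriv_deviation c u : log_deriv c w u =
  \sum_k c ord0 k * (cexp (pairing (exponent k) w) * (deviation C p u k + center u)).
Proof. by apply: eq_bigr => k _; rewrite -(pairing_deviation k u). Qed.

(** Together with [deriv_attained] this computes the distance from f to the polynomials whose value
    and derivative along u vanish at the point. The scalar l is the one minimized over in the
    projective distance; the product form also covers a support norm equal to zero. *)
Lemma deriv_bound f g u (l : R[i]) :
  log_eval f w = 0 -> log_eval g w = 0 -> log_deriv g w u = 0 ->
  normc (log_deriv f w u) ^+ 2 <=
  pnorm C (f - l *: g) ^+ 2 * (kappa * support_norm C p u ^+ 2).
Proof.
rewrite !log_deriv_deviation -deviation_dual_norm pnorm_sqr => f0 g0 gu.
have := distance_ge C_gt0 l f0 g0 gu.
by congr (_ <= _ * _); apply: eq_bigr => k _; rewrite !mxE.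
Qed.

Lemma deriv_attained f u : log_eval f w = 0 ->
  exists2 g, log_eval g w = 0 /\ log_deriv g w u = 0 &
  pnorm C (f - g) ^+ 2 =
    normc (log_deriv f w u) ^+ 2 / (kappa * support_norm C p u ^+ 2).
Proof.
move=> f0; have [g [gv gu] fg] :=
  distance_attained C_gt0 (center u) f0 (deviation_orthogonal u).
exists (\row_k g k).
  rewrite log_deriv_deviation; split.
    by rewrite -[RHS]gv; apply: eq_bigr => k _; rewrite mxE.
  by rewrite -[RHS]gu; apply: eq_bigr => k _; rewrite mxE.
rewrite log_deriv_deviation -deviation_dual_norm -fg pnorm_sqr.
by apply: eq_bigr => k _; rewrite !mxE.
Qed.

End OneSupport.

(** * Inverting the Jacobian in logarithmic coordinates *)

Section InverseJacobian.
Context (R : realType) (n : nat) (A : 'I_n -> {fset 'rV[int]_n}).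
Local Notation C := R[i].
Local Notation system := 'rV[C]_(\sum_i #|{: A i}|).

Definition log_jacobian (f : system) (w u : 'rV[C]_n) : 'rV[C]_n :=
  \row_i log_deriv (component f i) w u.

Lemma log_jacobianE (f : system) (w u : 'rV[C]_n) :
  log_jacobian f w u =
  u *m (diag_mx (cexpv w) *m jacobian (sys_eval f) (cexpv w)).
Proof.
rewrite mulmxA jacobian_cexpv; apply/rowP => i; rewrite !mxE; congr log_deriv.
by apply/rowP => j; rewrite mul_mx_diag !mxE mulfK// cexp_neq0.
Qed.

(** The chain rule for x = exp w contributes the diagonal factor, invertible because exponentials do
    not vanish; the Jacobian is invertible by its rank. *)
Lemma log_jacobian_inverse (f : system) (w : 'rV[C]_n) : jac_rank f w = n ->
  exists S : 'M[C]_n, (forall y, log_jacobian f w (y *m S) = y) /\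
                      (forall u, log_jacobian f w u *m S = u).
Proof.
move=> rk.
have Ju : jacobian (sys_eval f) (cexpv w) \in unitmx.
  by rewrite -row_full_unit /row_full -/(jac_rank f w) rk.
have Du : diag_mx (cexpv w) \in unitmx.
  rewrite unitmxE det_diag unitfE; apply/prodf_neq0 => j _; exact: cexpv_neq0.
exists (invmx (diag_mx (cexpv w) *m jacobian (sys_eval f) (cexpv w))).
have U : diag_mx (cexpv w) *m jacobian (sys_eval f) (cexpv w) \in unitmx.
  by rewrite unitmx_mul Du Ju.
by split=> y; rewrite log_jacobianE ?mulmxK// mulmxKV.
Qed.

End InverseJacobian.

(** * Compactness of complex ellipsoids *)

Section ComplexContinuity.
Context (R : realType) (T : topologicalType).
Local Notation C := R[i].

(** Continuity is expressed by real and imaginary parts because the maximization takes place over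
    real parameters. *)
Definition complex_continuous (z : T -> C) : Prop :=
  continuous (fun t => complex.Re (z t)) /\ continuous (fun t => complex.Im (z t)).

Lemma complex_continuous_cst (a : C) : complex_continuous (fun=> a).
Proof. by split=> t; apply: cst_continuous. Qed.

Lemma complex_continuousD z1 z2 : complex_continuous z1 -> complex_continuous z2 ->
  complex_continuous (fun t => z1 t + z2 t).
Proof.
move=> [r1 i1] [r2 i2]; split.
  have -> : (fun t => complex.Re (z1 t + z2 t)) =
      (fun t => complex.Re (z1 t) + complex.Re (z2 t)).
    by apply/funext => s; case: (z1 s) (z2 s) => [? ?] [? ?].
  by move=> t; apply: cvgD; [exact: r1|exact: r2].
have -> : (fun t => complex.Im (z1 t + z2 t)) =
    (fun t => complex.Im (z1 t) + complex.Im (z2 t)).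
  by apply/funext => s; case: (z1 s) (z2 s) => [? ?] [? ?].
by move=> t; apply: cvgD; [exact: i1|exact: i2].
Qed.

Lemma complex_continuousM z1 z2 : complex_continuous z1 -> complex_continuous z2 ->
  complex_continuous (fun t => z1 t * z2 t).
Proof.
move=> [r1 i1] [r2 i2]; split.
  have -> : (fun t => complex.Re (z1 t * z2 t)) =
      (fun t => complex.Re (z1 t) * complex.Re (z2 t)
              - complex.Im (z1 t) * complex.Im (z2 t)).
    by apply/funext => s; case: (z1 s) (z2 s) => [? ?] [? ?].
  by move=> t; apply: cvgB; apply: cvgM; [exact: r1|exact: r2|exact: i1|exact: i2].
have -> : (fun t => complex.Im (z1 t * z2 t)) =
    (fun t => complex.Re (z1 t) * complex.Im (z2 t)
            + complex.Im (z1 t) * complex.Re (z2 t)).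
  by apply/funext => s; case: (z1 s) (z2 s) => [? ?] [? ?].
by move=> t; apply: cvgD; apply: cvgM; [exact: r1|exact: i2|exact: i1|exact: r2].
Qed.

Lemma complex_continuous_sum (I : Type) (r : seq I) (z : I -> T -> C) :
  (forall i, complex_continuous (z i)) ->
  complex_continuous (fun t => \sum_(i <- r) z i t).
Proof.
move=> zc; elim: r => [|i r ih].
  under eq_fun do rewrite big_nil.
  exact: complex_continuous_cst.
under eq_fun do rewrite big_cons.
exact: complex_continuousD.
Qed.

Lemma normc_sqr_continuous z : complex_continuous z ->
  continuous (fun t => normc (z t) ^+ 2).
Proof.
move=> [rc ic].
have -> : (fun t => normc (z t) ^+ 2) =
    (fun t => complex.Re (z t) * complex.Re (z t) + complex.Im (z t) * complex.Im (z t)).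
  apply/funext => s; case: (z s) => a b /=.
  by rewrite sqr_sqrtr ?addr_ge0 ?sqr_ge0// !expr2.
by move=> t; apply: cvgD; apply: cvgM; [exact: rc|exact: rc|exact: ic|exact: ic].
Qed.

Lemma continuousMcst (g : T -> R) (a : R) :
  continuous g -> continuous (fun t => g t * a).
Proof. by move=> gc t; apply: cvgM; [exact: gc|exact: cvg_cst]. Qed.

Lemma continuous_sumE (I : Type) (r : seq I) (g : I -> T -> R) :
  (forall i, continuous (g i)) -> continuous (fun t => \sum_(i <- r) g i t).
Proof.
move=> gc; elim: r => [|i r ih] t.
  under eq_fun do rewrite big_nil.
  exact: cvg_cst.
under eq_fun do rewrite big_cons.
by apply: cvgD; [exact: gc|exact: ih].
Qed.

End ComplexContinuity.

Section Ellipsoid.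
Context (R : realType) (n : nat).
Local Notation C := R[i].

(** C^n is parametrized by R^(2n), where boxes are compact and the extreme value theorem applies. *)
Definition complex_row (t : 'rV[R]_(n + n)) : 'rV[C]_n :=
  \row_j (t ord0 (lshift n j) +i* t ord0 (rshift n j)).

Lemma complex_row_surj (y : 'rV[C]_n) : exists t, complex_row t = y.
Proof.
exists (row_mx (map_mx (@complex.Re R) y) (map_mx (@complex.Im R) y)).
by apply/rowP => j; rewrite mxE row_mxEl row_mxEr !mxE; case: (y _ _).
Qed.

Lemma complex_continuous_row j : complex_continuous (fun t => complex_row t ord0 j).
Proof.
split.
  have -> : (fun t => complex.Re (complex_row t ord0 j)) =
      (fun t => t ord0 (lshift n j)).
    by apply/funext => s; rewrite mxE.
  exact: coord_continuous.
have -> : (fun t => complex.Im (complex_row t ord0 j)) =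
    (fun t => t ord0 (rshift n j)).
  by apply/funext => s; rewrite mxE.
exact: coord_continuous.
Qed.

Variable b : 'I_n -> R.
Hypothesis b_gt0 : forall i, 0 < b i.

Definition ellipsoid (y : 'rV[C]_n) : Prop :=
  \sum_i normc (y ord0 i) ^+ 2 / b i <= 1.

Lemma ellipsoid_continuous :
  continuous (fun t => \sum_i normc (complex_row t ord0 i) ^+ 2 / b i).
Proof.
apply: continuous_sumE => i; apply: continuousMcst.
by apply: normc_sqr_continuous; exact: complex_continuous_row.
Qed.

Lemma compact_ellipsoid : compact [set t | ellipsoid (complex_row t)].
Proof.
(* Every |y_i|^2 is at most b_i <= B. The added 1 gives B <= B^2, so that x^2 <= B implies |x| <=
   B. *)
pose B := \sum_i b i + 1.
have box : compact [set t : 'rV[R]_(n + n) | forall i, `[- B, B]%classic (t ord0 i)].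
  by apply: (@rV_compact _ _ (fun=> `[- B, B]%classic)) => _; exact: segment_compact.
apply: subclosed_compact _ box _.
  apply: (@closed_comp _ _ _ [set x : R | x <= 1]) => [t _|]; last exact: closed_le.
  exact: ellipsoid_continuous.
have B0 : 1 <= B by rewrite lerDr sumr_ge0// => i _; exact: ltW.
have sq_le (x : R) : x ^+ 2 <= B -> `[- B, B]%classic x.
  move=> xB; rewrite /= in_itv /= -ler_norml.
  have : `|x| ^+ 2 <= B ^+ 2.
    by rewrite real_normK ?num_real// (le_trans xB)// expr2 ler_peMl// (le_trans ler01).
  by rewrite ler_pXn2r ?nnegrE// (le_trans ler01).
move=> t tE j; apply: sq_le.
have key i : normc (complex_row t ord0 i) ^+ 2 <= B.
  have : normc (complex_row t ord0 i) ^+ 2 / b i <= 1.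
    apply: le_trans tE; rewrite (bigD1 i)//= lerDl sumr_ge0// => k _.
    by rewrite divr_ge0 ?sqr_ge0// ltW.
  rewrite ler_pdivrMr// mul1r => /le_trans; apply.
  rewrite /B (bigD1 i)//= -addrA lerDl addr_ge0// sumr_ge0// => k _; exact: ltW.
case: (split_ordP j) => i ->; apply: le_trans (key i); rewrite mxE /=.
  by rewrite sqr_sqrtr ?addr_ge0 ?sqr_ge0// lerDl sqr_ge0.
by rewrite sqr_sqrtr ?addr_ge0 ?sqr_ge0// lerDr sqr_ge0.
Qed.

Lemma ellipsoid_max (Phi : 'rV[C]_n -> R) :
  continuous (fun t => Phi (complex_row t)) ->
  exists2 y, ellipsoid y & forall z, ellipsoid z -> Phi z <= Phi y.
Proof.
move=> Phic.
have E0 : [set t | ellipsoid (complex_row t)] !=set0.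
  have [t t0] := complex_row_surj 0; exists t => /=; rewrite t0 /ellipsoid.
  rewrite big1 ?ler01// => i _.
  by rewrite mxE ComplexField.Normc.normc0 expr0n mul0r.
have [t tE tmax] := EVT_max_rV E0 compact_ellipsoid (continuous_subspaceT Phic).
exists (complex_row t); first by rewrite inE in tE.
move=> z; have [s <-] := complex_row_surj z => sE.
by apply: tmax; rewrite inE.
Qed.

End Ellipsoid.

(** * Condition numbers and the distance to the degenerate locus *)

Lemma continuous_bigmin (R : realType) (T : topologicalType) (I : Type) (r : seq I)
    (g0 : T -> R) (g : I -> T -> R) :
  continuous g0 -> (forall i, continuous (g i)) ->
  continuous (fun t => \big[Num.min/g0 t]_(i <- r) g i t).
Proof.
move=> g0c gc; elim: r => [|i r ih] t.
  by under eq_fun do rewrite big_nil; exact: g0c.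
under eq_fun do rewrite big_cons.
exact: (@continuous_min _ _ _ _ t (gc i t) (ih t)).
Qed.

Lemma continuous_bigmax (R : realType) (T : topologicalType) (I : Type) (r : seq I)
    (g0 : T -> R) (g : I -> T -> R) :
  continuous g0 -> (forall i, continuous (g i)) ->
  continuous (fun t => \big[Num.max/g0 t]_(i <- r) g i t).
Proof.
move=> g0c gc; elim: r => [|i r ih] t.
  by under eq_fun do rewrite big_nil; exact: g0c.
under eq_fun do rewrite big_cons.
exact: (@continuous_max _ _ _ _ t (gc i t) (ih t)).
Qed.

Section Condition.
Context (R : realType) (n : nat) (A : 'I_n -> {fset 'rV[int]_n}).
Context (C : forall i, 'M[R]_#|{: A i}|).
Hypothesis C_gt0 : forall i k, 0 < C i k k.
Variable k0 : forall i, 'I_#|{: A i}|.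
Local Notation system := 'rV[R[i]]_(\sum_i #|{: A i}|).
Context (f : system) (p q : 'rV[R]_n).
Local Notation w := (torus_point p q).
Local Notation F i := (pnorm (C i) (component f i)).
Local Notation N i u := (support_norm (C i) p u).
Hypothesis F_gt0 : forall i, 0 < F i.
Hypothesis f_root : is_root f w.
(** The inverse of the logarithmic Jacobian M, acting on rows from the right. *)
Variable S : 'M[R[i]]_n.
Hypothesis SK : forall y, log_jacobian f w (y *m S) = y.
Hypothesis KS : forall u, log_jacobian f w u *m S = u.

(** The squared semi-axes of the ellipsoid filled by the values h(x) when h runs over the unit
    ball. *)
Definition axis i : R := weight_sum (C i) p * F i ^+ 2.

Lemma axis_gt0 i : 0 < axis i.
Proof. by rewrite mulr_gt0 ?exprn_gt0// (weight_sum_gt0 (@C_gt0 i) (k0 i)). Qed.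

Lemma tangent_ballE h :
  (tangent_norm C f h <= 1) = (\sum_i (pnorm (C i) (component h i) / F i) ^+ 2 <= 1).
Proof.
rewrite /tangent_norm -[X in _ <= X]sqrtr1 ler_psqrt ?qualifE//=.
by apply: sumr_ge0 => i _; rewrite sqr_ge0.
Qed.

Lemma ball_ellipsoid h (u : 'rV[R[i]]_n) : tangent_norm C f h <= 1 ->
  (forall i, log_eval (component h i) w + log_deriv (component f i) w u = 0) ->
  ellipsoid axis (log_jacobian f w u).
Proof.
rewrite tangent_ballE => hb hu; apply: le_trans hb; apply: ler_sum => i _.
have := eval_bound (@C_gt0 i) p q (component h i).
have /eqP := hu i; rewrite addr_eq0 => /eqP ->; rewrite mxE.
rewrite normcN => b.
rewrite ler_pdivrMr ?axis_gt0// (le_trans b)// le_eqVlt; apply/orP; left; apply/eqP.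
by rewrite /axis; field; rewrite lt0r_neq0.
Qed.

(** Each h^i is the representer given by [eval_attained], for which Cauchy-Schwarz is an equality.
    The sign comes from M (DG_f h) = - h(x). *)
Lemma ellipsoid_ball (y : 'rV[R[i]]_n) : ellipsoid axis y ->
  exists2 h : system, tangent_norm C f h <= 1 &
    forall i, log_eval (component h i) w = - y ord0 i.
Proof.
move=> yE.
have H i : {c : 'rV[R[i]]_#|{: A i}| | log_eval c w = - y ord0 i &
    pnorm (C i) c ^+ 2 = normc (- y ord0 i) ^+ 2 / weight_sum (C i) p}.
  by apply: cid2; exact: (eval_attained (@C_gt0 i) (k0 i)).
have hE i : component (\mxrow_i s2val (H i)) i = s2val (H i).
  by rewrite /component mxrowK.
exists (\mxrow_i s2val (H i)); last by move=> i; rewrite hE; exact: (s2valP (H i)).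
rewrite tangent_ballE; apply: le_trans yE; apply: ler_sum => i _.
rewrite hE exprMn exprVn (s2valP' (H i)) normcN le_eqVlt; apply/orP; left; apply/eqP.
by rewrite /axis; field; rewrite !lt0r_neq0// (weight_sum_gt0 (@C_gt0 i) (k0 i)).
Qed.

Lemma support_norm_continuous i :
  continuous (fun t => N i (complex_row t *m S)).
Proof.
have -> : (fun t => N i (complex_row t *m S)) = (fun t => Num.sqrt (\sum_k
   weight (C i) p k / weight_sum (C i) p *
   normc (deviation (C i) p (complex_row t *m S) k) ^+ 2)).
  apply/funext => t; rewrite -(support_norm_sqr (@C_gt0 i) (k0 i)) sqrtr_sqr.
  by rewrite ger0_norm// sqrtr_ge0.
have c : continuous (fun t =>
   \sum_k normc (deviation (C i) p (complex_row t *m S) k) ^+ 2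
     * (weight (C i) p k / weight_sum (C i) p)).
  apply: continuous_sumE => k; apply: continuousMcst; apply: normc_sqr_continuous.
  apply: complex_continuous_sum => j; apply: complex_continuousM.
    exact: complex_continuous_cst.
  under eq_fun do rewrite mxE.
  apply: complex_continuous_sum => l; apply: complex_continuousM.
    exact: complex_continuous_row.
  exact: complex_continuous_cst.
under eq_fun do under eq_bigr do rewrite mulrC.
by move=> t; apply: continuous_comp; [exact: c | exact: sqrt_continuous].
Qed.

Lemma support_norm0 i : N i 0 = 0.
Proof.
by rewrite /support_norm trmx0 mulmx0 mxE /= sqrtr0.
Qed.

Lemma support_norm_ge0 i u : 0 <= N i u.
Proof. exact: sqrtr_ge0. Qed.

Lemma support_normZ i (a : R) u : N i (a%:C *: u) ^+ 2 = a ^+ 2 * N i u ^+ 2.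
Proof.
rewrite !(support_norm_sqr (@C_gt0 i) (k0 i)) mulr_sumr; apply: eq_bigr => k _.
have -> : deviation (C i) p (a%:C *: u) k = a%:C * deviation (C i) p u k.
  by rewrite mulr_sumr; apply: eq_bigr => j _; rewrite mxE mulrCA.
by rewrite ComplexField.Normc.normcM normc_real exprMn real_normK ?num_real// mulrCA.
Qed.

(** The i-th summand of the squared projective distance. *)
Let gap g i : R := inf [set pnorm (C i) (component f i - l *: component g i) ^+ 2 /
  F i ^+ 2 | l in [set l : R[i] | l != 0]].

Lemma gap_lb g i x :
  (forall l, x <= pnorm (C i) (component f i - l *: component g i) ^+ 2 / F i ^+ 2) ->
  x <= gap g i.
Proof.
move=> xl; apply: lb_le_inf; last by move=> _ [l _ <-]; exact: xl.
by eexists; exists 1 => //=; exact: oner_neq0.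
Qed.

Lemma gap_ge0 g i : 0 <= gap g i.
Proof. by apply: gap_lb => l; rewrite divr_ge0 ?sqr_ge0. Qed.

Lemma gap_le g i :
  gap g i <= pnorm (C i) (component f i - component g i) ^+ 2 / F i ^+ 2.
Proof.
apply: ge_inf; last by exists 1; [exact: oner_neq0 | rewrite scale1r].
by exists 0 => _ [l _ <-]; rewrite divr_ge0 ?sqr_ge0.
Qed.

(** Let u be a kernel direction of g, y = M u, and s the value at y of the quadratic form defining
    the ellipsoid. Summing [step1] over i and bounding each norm of u by [step2] gives s <= hi^2
    (sum of gaps) s, and s is positive. *)
Lemma proj_dist_ge (g : system) (hi : R) : 0 <= hi ->
  (forall y, ellipsoid axis y -> forall i, N i (y *m S) <= hi) ->
  degenerate_locus A w g -> 1 <= hi * proj_dist C f g.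
Proof.
move=> hi0 hiP [/is_rootP g0 /jac_rank_ltP[u u0 gu]].
pose y := log_jacobian f w u.
have y0 : y != 0.
  by apply: contra u0 => /eqP y0; rewrite -(KS u) -/y y0 mul0mx.
pose s : R := \sum_i normc (y ord0 i) ^+ 2 / axis i.
have s0 : 0 < s.
  have /rV0Pn[j yj] := y0.
  rewrite /s (bigD1 j)//= ltr_pwDl//.
    by rewrite divr_gt0 ?axis_gt0// exprn_gt0// lt_neqAle eq_sym normc_eq0 yj normc_ge0.
  by rewrite sumr_ge0// => i _; rewrite divr_ge0 ?sqr_ge0// ltW// axis_gt0.
have f0 := (is_rootP f w).1 f_root.
have step1 i : normc (y ord0 i) ^+ 2 / axis i <= gap g i * N i u ^+ 2.
  have B l := deriv_bound (@C_gt0 i) (k0 i) l (f0 i) (g0 i) (gu i).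
  (* If the support norm of u is zero, [deriv_bound] forces y_i = 0, and the inequality is
     trivial. *)
  rewrite mxE; have [N0|N0] := eqVneq (N i u) 0.
    have := B 0; rewrite N0 expr0n !mulr0 => H.
    by rewrite mulr_le0_ge0// invr_ge0 ltW// axis_gt0.
  have N0' : 0 < N i u ^+ 2 by rewrite exprn_gt0// lt_neqAle eq_sym N0 support_norm_ge0.
  rewrite -ler_pdivrMr//; apply: gap_lb => l.
  rewrite ler_pdivrMr// ler_pdivrMr ?axis_gt0// (le_trans (B l))//.
  rewrite le_eqVlt; apply/orP; left; apply/eqP.
  by rewrite /axis; field; rewrite lt0r_neq0.
have step2 i : N i u ^+ 2 <= hi ^+ 2 * s.
  (* Scaling y by s^(-1/2) puts it on the boundary of the ellipsoid, where [hi] bounds the norms. *)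
  pose a := (Num.sqrt s)^-1.
  have a2 : a ^+ 2 = s^-1 by rewrite exprVn sqr_sqrtr// ltW.
  have yE : ellipsoid axis (a%:C *: y).
    rewrite /ellipsoid.
    have -> : \sum_i normc ((a%:C *: y) ord0 i) ^+ 2 / axis i = a ^+ 2 * s.
      rewrite mulr_sumr; apply: eq_bigr => j _.
      rewrite mxE ComplexField.Normc.normcM normc_real exprMn.
      by rewrite real_normK ?num_real// -mulrA.
    by rewrite a2 mulVf// lt0r_neq0.
  have := hiP _ yE i; rewrite -scalemxAl KS => Nle.
  have : N i (a%:C *: u) ^+ 2 <= hi ^+ 2.
    by rewrite ler_pXn2r ?nnegrE// support_norm_ge0.
  by rewrite support_normZ a2 ler_pdivrMl// mulrC.
have : s <= (hi ^+ 2 * \sum_i gap g i) * s.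
  rewrite {1}/s [leRHS]mulrAC mulr_sumr; apply: ler_sum => i _.
  by rewrite (le_trans (step1 i))// mulrC ler_wpM2r// gap_ge0.
rewrite -{1}[s]mul1r ler_pM2r// => H.
have P0 : 0 <= hi * proj_dist C f g by rewrite mulr_ge0// sqrtr_ge0.
rewrite -(@ler_pXn2r _ 2) ?nnegrE// expr1n exprMn /proj_dist sqr_sqrtr//.
by apply: sumr_ge0 => i _; exact: gap_ge0.
Qed.

(** With u = M^-1 y, each f^i is replaced by the nearest polynomial whose value and derivative along
    u vanish. The resulting sum is at most lo^-2 times the ellipsoid sum of y, hence at most
    lo^-2. *)
Lemma proj_dist_le (y : 'rV[R[i]]_n) (lo : R) (i0 : 'I_n) : 0 < lo ->
  ellipsoid axis y -> (forall i, lo <= N i (y *m S)) ->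
  exists2 g, degenerate_locus A w g & proj_dist C f g <= lo^-1.
Proof.
move=> lo0 yE loP; pose u := y *m S.
have f0 := (is_rootP f w).1 f_root.
have H i : {c | log_eval c w = 0 /\ log_deriv c w u = 0 &
    pnorm (C i) (component f i - c) ^+ 2 = normc (log_deriv (component f i) w u) ^+ 2 /
      (weight_sum (C i) p * N i u ^+ 2)}.
  by apply: cid2; exact: (deriv_attained (@C_gt0 i) (k0 i) u (f0 i)).
pose g : system := \mxrow_i s2val (H i).
have gE i : component g i = s2val (H i) by rewrite /component mxrowK.
exists g.
  split; first by apply/is_rootP => i; rewrite gE; have [] := s2valP (H i).
  apply/jac_rank_ltP; exists u; last by move=> i; rewrite gE; have [] := s2valP (H i).
  (* The direction u is nonzero since its support norms are at least [lo], which is positive. *)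
  apply/eqP => u0; have := loP i0; rewrite -/u u0 support_norm0.
  by rewrite leNgt lo0.
have li0 : 0 <= lo^-1 by rewrite invr_ge0 ltW.
rewrite -[leRHS]ger0_norm// -sqrtr_sqr ler_wsqrtr//.
apply: (@le_trans _ _ (\sum_i normc (y ord0 i) ^+ 2 / axis i * lo^-1 ^+ 2)); last first.
  by rewrite -mulr_suml ler_piMl// sqr_ge0.
apply: ler_sum => i _; apply: le_trans (gap_le g i) _.
rewrite gE (s2valP' (H i)).
have -> : log_deriv (component f i) w u = y ord0 i by rewrite -[in RHS](SK y) mxE.
have N0 : 0 < N i u by apply: lt_le_trans (loP i).
have K0 := weight_sum_gt0 (@C_gt0 i) (k0 i) p.
have -> : normc (y ord0 i) ^+ 2 / (weight_sum (C i) p * N i u ^+ 2) / F i ^+ 2 =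
    normc (y ord0 i) ^+ 2 / axis i * (N i u)^-1 ^+ 2.
  by rewrite /axis; field; rewrite !lt0r_neq0.
rewrite ler_wpM2l ?divr_ge0 ?sqr_ge0 ?(ltW (axis_gt0 i))//.
rewrite ler_pXn2r ?nnegrE ?invr_ge0 ?(ltW N0) ?(ltW lo0)//.
by rewrite lef_pV2 ?posrE//; exact: loP.
Qed.

End Condition.

(** * The two inequalities and the case of equal supports *)

Lemma is_max_unique (R : realType) (X : set R) (a b : R) :
  is_max X a -> is_max X b -> a = b.
Proof. by move=> [Xa ua] [Xb ub]; apply/eqP; rewrite eq_le ub// ua. Qed.

Lemma is_max_all_equal (R : realType) (T : Type) n (B : set T) (D : 'I_n.+1 -> T -> R)
    (lo hi : R) :
  is_max [set \big[Num.min/D ord0 h]_(i < n.+1) D i h | h in B] lo ->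
  is_max [set \big[Num.max/D ord0 h]_(i < n.+1) D i h | h in B] hi ->
  (forall i h, D i h = D ord0 h) ->
  lo = hi /\ forall i, is_max [set D i h | h in B] hi.
Proof.
move=> loP hiP D_eq.
have minE h : \big[Num.min/D ord0 h]_(i < n.+1) D i h = D ord0 h.
  apply/eqP; rewrite eq_le bigmin_le /=.
  by apply: le_bigmin => // i _; rewrite (D_eq i).
have maxE h : \big[Num.max/D ord0 h]_(i < n.+1) D i h = D ord0 h.
  apply/eqP; rewrite eq_le le_bigmax andbT.
  by apply: bigmax_le => // i _; rewrite (D_eq i).
have D_max i : is_max [set D i h | h in B] hi.
  by under eq_imagel => h _ do rewrite (D_eq i) -maxE.
split=> //; apply: is_max_unique (D_max ord0).
by under eq_imagel => h _ do rewrite -minE.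
Qed.

(** If f^i were zero, the i-th coordinate of M u would vanish for every u, and M would miss the i-th
    basis vector. *)
Lemma nondegenerate_component (R : realType) n (A : 'I_n -> {fset 'rV[int]_n})
    (f : system R A) (w : 'rV[R[i]]_n) :
  jac_rank f w = n -> forall i, exists k, component f i ord0 k != 0.
Proof.
move=> rk i; have [S [SK _]] := log_jacobian_inverse rk.
apply/not_existsP => f0.
have := congr1 (fun M : 'rV_n => M ord0 i) (SK (delta_mx ord0 i)).
rewrite !mxE !eqxx /= /log_deriv big1 => [/esym/eqP|k _]; first by rewrite oner_eq0.
by have /negP := f0 k; rewrite negbK => /eqP ->; rewrite mul0r.
Qed.

Theorem theorem4 (R : realType) (n : nat)
    (A : 'I_n.+1 -> {fset 'rV[int]_n.+1})
    (C : forall i : 'I_n.+1, 'M[R]_#|{: A i}|)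
    (hC : forall i : 'I_n.+1, is_diag_mx (C i) /\ posdef_mx (C i))
    (f : system R A) (p q : 'rV[R]_n.+1)
    (hf : nondegenerate_root f (torus_point p q))
    (G : system R A -> 'rV[R[i]]_n.+1)
    (hG : implicit_branch f (torus_point p q) G) :
  let ball : set (system R A) := [set h | tangent_norm C f h <= 1] in
  let DGnorm (i : 'I_n.+1) (h : system R A) : R :=
    support_norm (C i) p ('d G f h) in
  let d : R := proj_dist_set C f (degenerate_locus A (torus_point p q)) in
  exists lo hi : R,
    [/\ is_max [set \big[Num.min/DGnorm ord0 h]_(i < n.+1) DGnorm i h
                 | h in ball] lo,
        is_max [set \big[Num.max/DGnorm ord0 h]_(i < n.+1) DGnorm i h
                 | h in ball] hi,
        0 < d,
        lo <= d^-1 <= hi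
      & (forall i j : 'I_n.+1,
           existT (fun B : {fset 'rV[int]_n.+1} => 'M[R]_#|{: B}|) (A i) (C i)
           = existT (fun B : {fset 'rV[int]_n.+1} => 'M[R]_#|{: B}|) (A j) (C j)) ->
        exists M : 'I_n.+1 -> R,
          [/\ forall i : 'I_n.+1, is_max [set DGnorm i h | h in ball] (M i),
              lo = \big[Num.max/M ord0]_(i < n.+1) M i
            & \big[Num.max/M ord0]_(i < n.+1) M i = d^-1]].
Proof.
move=> ball DGnorm d.
have C_gt0 i k : 0 < C i k k by have [_ /diag_posdef_gt0] := hC i; apply.
have [f_root rk] := hf.
have fk := nondegenerate_component rk.
(* An index with nonzero coefficient shows both that the i-th support is nonempty and that f^i has
   positive norm. *)
pose k0 i := projT1 (cid (fk i)).
have F_gt0 i : 0 < pnorm (C i) (component f i).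
  rewrite sqrtr_gt0 (bigD1 (k0 i))//= ltr_pwDl//.
    rewrite divr_gt0// exprn_gt0// lt_neqAle eq_sym normc_eq0 normc_ge0 andbT.
    exact: projT2 (cid (fk i)).
  by rewrite sumr_ge0// => k _; rewrite divr_ge0 ?sqr_ge0// ltW.
have [S [SK KS]] := log_jacobian_inverse rk.
pose b := axis C f p.
have dG := implicit_diff hG.
have ball_ell h : ball h -> exists2 y, ellipsoid b y & 'd G f h = y *m S.
  move=> hb; exists (log_jacobian f (torus_point p q) ('d G f h)); last by rewrite KS.
  exact: (ball_ellipsoid C_gt0 k0 F_gt0 hb (dG h)).
have ell_ball y : ellipsoid b y -> exists2 h, ball h & 'd G f h = y *m S.
  move=> yE; have [h hb hy] := ellipsoid_ball C_gt0 k0 q F_gt0 yE.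
  exists h => //; rewrite -[LHS]KS; congr (_ *m S); apply/rowP => i; rewrite mxE.
  by have /eqP := dG h i; rewrite hy addrC subr_eq0 => /eqP.
(* DG_f maps the ball onto the image of the ellipsoid under [S], so maxima over the ball are
   obtained from compactness of the ellipsoid. *)
have maxP (Phi : 'rV[R[i]]_n.+1 -> R) :
    continuous (fun t => Phi (complex_row t *m S)) ->
    exists m, is_max [set Phi ('d G f h) | h in ball] m.
  move=> Phic; have [y yE ymax] := ellipsoid_max (axis_gt0 C_gt0 k0 p F_gt0)
    (Phi := fun y => Phi (y *m S)) Phic.
  exists (Phi (y *m S)); split; first by have [h hb <-] := ell_ball y yE; exists h.
  by move=> _ [h /ball_ell[z zE ->] <-]; exact: ymax.
pose N i u := support_norm (C i) p u.
have Nc i : continuous (fun t => N i (complex_row t *m S)).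
  exact: support_norm_continuous.
have [lo loP] : exists lo, is_max
    [set \big[Num.min/DGnorm ord0 h]_(i < n.+1) DGnorm i h | h in ball] lo.
  apply: (maxP (fun u => \big[Num.min/N ord0 u]_(i < n.+1) N i u)).
  exact: (@continuous_bigmin _ _ _ _
    (fun t => N ord0 (complex_row t *m S)) _ (Nc ord0) Nc).
have [hi hiP] : exists hi, is_max
    [set \big[Num.max/DGnorm ord0 h]_(i < n.+1) DGnorm i h | h in ball] hi.
  apply: (maxP (fun u => \big[Num.max/N ord0 u]_(i < n.+1) N i u)).
  exact: (@continuous_bigmax _ _ _ _
    (fun t => N ord0 (complex_row t *m S)) _ (Nc ord0) Nc).
have hi_ub y : ellipsoid b y -> forall i, N i (y *m S) <= hi.
  move=> /ell_ball[h hb <-] i; have [_ /(_ _ (ex_intro2 _ _ h hb erefl))] := hiP.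
  exact: le_trans (le_bigmax _ _ i).
have hi0 : 0 <= hi.
  have [[h /ball_ell[y yE _] _] _] := hiP.
  exact: le_trans (support_norm_ge0 _ _ ord0 _) (hi_ub y yE ord0).
set L := degenerate_locus A (torus_point p q).
have L_ge g : L g -> 1 <= hi * proj_dist C f g.
  exact: (proj_dist_ge C_gt0 k0 F_gt0 f_root KS hi0 hi_ub).
(* The zero system makes the set of distances nonempty and, through [L_ge], excludes hi = 0. *)
have L0 : L 0.
  split.
    by apply/is_rootP => i; rewrite /log_eval big1// => k _; rewrite !mxE mul0r.
  apply/jac_rank_ltP; exists (delta_mx ord0 ord0).
    by apply/eqP => /rowP /(_ ord0) /eqP; rewrite !mxE oner_eq0.
  by move=> i; rewrite /log_deriv big1// => k _; rewrite !mxE mul0r.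
have hi_gt0 : 0 < hi.
  rewrite lt_neqAle hi0 andbT; apply/eqP => hiE; have := L_ge 0 L0.
  by rewrite -hiE mul0r ler10.
have d_ge : hi^-1 <= d.
  apply: lb_le_inf; first by exists (proj_dist C f 0); exists 0.
  by move=> _ [g /L_ge + <-]; rewrite -ler_pdivrMl// mulr1.
have d0 : 0 < d by apply: lt_le_trans d_ge; rewrite invr_gt0.
have d_hi : d^-1 <= hi by rewrite -[hi]invrK lef_pV2 ?posrE ?invr_gt0.
have lo_d : lo <= d^-1.
  (* A nonpositive [lo] is trivially below d^-1. Otherwise a maximizing h supplies the point y of
     the ellipsoid for [proj_dist_le]. *)
  have [lo0|lo0] := leP lo 0; first by rewrite (le_trans lo0)// invr_ge0 ltW.
  have [[h /ball_ell[y yE hy] loE] _] := loP.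
  have loN i : lo <= N i (y *m S) by rewrite -hy -loE; exact: bigmin_le.
  have [g Lg gd] := proj_dist_le C_gt0 k0 F_gt0 f_root SK ord0 lo0 yE loN.
  rewrite -[lo]invrK lef_pV2 ?posrE ?invr_gt0//; apply: le_trans gd.
  by apply: ge_inf; [exists 0 => _ [g' _ <-]; exact: sqrtr_ge0 | exists g].
exists lo, hi; split => //; first by rewrite lo_d d_hi.
move=> AC.
(* The type of [C i] depends on [A i], so the norm is rewritten along the equality of the dependent
   pairs. *)
have D_eq i h : DGnorm i h = DGnorm ord0 h.
  exact: (congr1 (fun s : {B : {fset 'rV[int]_n.+1} & 'M[R]_#|{: B}|} =>
    support_norm (projT2 s) p ('d G f h)) (AC i ord0)).
have [lohi E1] := is_max_all_equal loP hiP D_eq.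
have hE : \big[Num.max/hi]_(i < n.+1) hi = hi.
  by apply/eqP; rewrite eq_le bigmax_le//= bigmax_ge_id.
(* All the norms coincide, so every individual maximum is [hi]; since lo = hi, the two inequalities
   pin down d^-1. *)
exists (fun=> hi); split => //; rewrite hE //.
by apply/eqP; rewrite eq_le d_hi -lohi lo_d.
Qed.
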